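(* For every $n\ge 3$, the mis\`ere SOS game on a $1\times n$ grid is a draw.
   Context: Mis\`ere SOS game: on a $1\times n$ grid, initially empty, two players alternately write either an S or an O in an empty cell. The first player whose move produces three consecutive cells spelling SOS loses (no matter who wrote the individual letters). If all cells are filled without producing SOS, the play ends in a draw. Both players are assumed to play optimally: ''the game is a draw'' means that each player has a strategy guaranteeing that they do not lose. *)

(* Defs.v *)
From HB Require Import structures.
From mathcomp Require Import all_boot.

Set Implicit Arguments.
Unset Strict Implicit.
Unset Printing Implicit Defensive.

Variant letter := LetterS | LetterO.

Definition bool_of_letter (l : letter) : bool :=
  if l is LetterS then true else false.
Definition letter_of_bool (b : bool) : letter :=
  if b then LetterS else LetterO.
Lemma bool_of_letterK : cancel bool_of_letter letter_of_bool.
Proof. by case. Qed.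
HB.instance Definition _ := Finite.copy letter (can_type bool_of_letterK).

Variant player := First | Second.

Definition board (n : nat) := {ffun 'I_n -> option letter}.

Definition empty_board (n : nat) : board n := [ffun _ => None].

Definition move (n : nat) := ('I_n * letter)%type.

Definition put (n : nat) (b : board n) (m : move n) : board n :=
  [ffun i => if i == m.1 then Some m.2 else b i].

Definition has_SOS (n : nat) (b : board n) : bool :=
  [exists i : 'I_n, exists j : 'I_n, exists k : 'I_n,
    [&& j == i.+1 :> nat, k == i.+2 :> nat,
        b i == Some LetterS, b j == Some LetterO & b k == Some LetterS]].

(* A history lists the moves made so far, oldest first. *)
Definition history (n : nat) := seq (move n).

Definition board_after (n : nat) (h : history n) : board n :=
  foldl (@put n) (empty_board n) h.

Definition to_move (n : nat) (h : history n) : player :=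
  if odd (size h) then Second else First.

(* No move is legal once SOS has appeared or all cells are filled, so the play
   is over exactly when no move is legal. *)
Definition legal_move (n : nat) (h : history n) (m : move n) : bool :=
  ~~ has_SOS (board_after h) && (board_after h m.1 == None).

Inductive legal_history (n : nat) : history n -> Prop :=
| legal_nil : legal_history [::]
| legal_rcons (h : history n) (m : move n) :
    legal_history h -> legal_move h m -> legal_history (rcons h m).

(* In a legal history, SOS can only have been produced by the last move. *)
Definition loses (n : nat) (p : player) (h : history n) : Prop :=
  exists (h' : history n) (m : move n),
    [/\ h = rcons h' m, to_move h' = p & has_SOS (board_after h)].

(* The value of a strategy matters only at histories where its owner is to move
   and the play is not over; there it has to be a legal move, as otherwise
   a strategy could avoid losing by getting stuck. *)
Definition strategy_for (n : nat) (p : player) (s : history n -> move n)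
    : Prop :=
  forall h : history n, legal_history h -> to_move h = p ->
    (exists m : move n, legal_move h m) -> legal_move h (s h).

Definition follows (n : nat) (p : player) (s : history n -> move n)
    (h : history n) : Prop :=
  forall (h1 h2 : history n) (m : move n),
    h = rcons h1 m ++ h2 -> to_move h1 = p -> m = s h1.

Definition can_avoid_losing (n : nat) (p : player) : Prop :=
  exists s : history n -> move n,
    strategy_for p s /\
    forall h : history n, legal_history h -> follows p s h -> ~ loses p h.

Definition misere_SOS_draw (n : nat) : Prop :=
  forall p : player, can_avoid_losing n p.

(* Main.v *)
Require Import Defs.
From mathcomp Require Import all_boot.

Set Implicit Arguments.
Unset Strict Implicit.
Unset Printing Implicit Defensive.

(** The game is a draw because no cell is ever poisonous for both letters. Let
    a board contain no SOS and let [i] be an empty cell. Writing O in [i] makes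
    SOS only when [i] is the middle cell of it, so that both neighbours of [i]
    hold S. Writing S in [i] makes SOS only when [i] is an end cell of it, so
    that some neighbour of [i] holds O. These two situations exclude each other,
    and therefore one of the two letters is harmless ([safe_letter]). Hence the
    player to move can always move without losing, and either player avoids
    losing by making any such move at every turn. *)

Lemma has_SOSP (n : nat) (b : board n) :
  reflect (exists i j k : 'I_n,
             [/\ j = i.+1 :> nat, k = i.+2 :> nat, b i = Some LetterS,
                 b j = Some LetterO & b k = Some LetterS])
          (has_SOS b).
Proof.
apply: (iffP existsP) => [[i /existsP[j /existsP[k]]] | [i [j [k [ij ik bi bj bk]]]]].
  by case/and5P=> /eqP ij /eqP ik /eqP bi /eqP bj /eqP bk; exists i, j, k.
exists i; apply/existsP; exists j; apply/existsP; exists k.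
by rewrite ij ik bi bj bk !eqxx.
Qed.

(** An SOS that was not there before uses the new letter, so O can only have
    become its middle. *)
Lemma SOS_after_O (n : nat) (b : board n) (i : 'I_n) :
  ~~ has_SOS b -> has_SOS (put b (i, LetterO)) ->
  forall j : 'I_n, (j == i.+1 :> nat) || (i == j.+1 :> nat) ->
  b j = Some LetterS.
Proof.
move=> noSOS /has_SOSP[x [y [z [xy xz]]]]; rewrite !ffunE /=.
case: (x =P i) => // _ bx; case: (z =P i) => [_ _ // | _].
case: (y =P i) => [yi _ bz | _ byO bz].
  move=> j /orP[] /eqP ij.
    by rewrite (_ : j = z) //; apply: val_inj; rewrite /= ij -yi xy xz.
  by rewrite (_ : j = x) //; apply: val_inj; apply: succn_inj; rewrite -ij -yi.
by case/negP: noSOS; apply/has_SOSP; exists x, y, z.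
Qed.

(** Dually, S can only have become an end, next to the middle O. *)
Lemma SOS_after_S (n : nat) (b : board n) (i : 'I_n) :
  ~~ has_SOS b -> has_SOS (put b (i, LetterS)) ->
  exists2 j : 'I_n, (j == i.+1 :> nat) || (i == j.+1 :> nat)
                    & b j = Some LetterO.
Proof.
move=> noSOS /has_SOSP[x [y [z [xy xz]]]]; rewrite !ffunE /=.
case: (y =P i) => // _.
case: (x =P i) => [xi _ byO _ | _ bx]; first by exists y; rewrite // xy xi eqxx.
case: (z =P i) => [zi byO _ | _ byO bz].
  by exists y; rewrite // -zi xz xy eqxx orbT.
by case/negP: noSOS; apply/has_SOSP; exists x, y, z.
Qed.

Lemma safe_letter (n : nat) (b : board n) (i : 'I_n) :
  ~~ has_SOS b -> exists l : letter, ~~ has_SOS (put b (i, l)).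
Proof.
move=> noSOS; have [OSOS | ] := boolP (has_SOS (put b (i, LetterO))); last first.
  by exists LetterO.
exists LetterS; apply/negP => /(SOS_after_S noSOS)[j adj_ij].
by rewrite (SOS_after_O noSOS OSOS adj_ij).
Qed.

Definition safe_move (n : nat) (h : history n) (m : move n) : bool :=
  legal_move h m && ~~ has_SOS (board_after (rcons h m)).

Lemma safe_move_exists (n : nat) (h : history n) (m : move n) :
  legal_move h m -> exists m' : move n, safe_move h m'.
Proof.
case/andP=> noSOS free; have [l safe_l] := safe_letter m.1 noSOS.
exists (m.1, l); rewrite /safe_move /legal_move noSOS free.
by rewrite /board_after foldl_rcons.
Qed.

(** The default [m0] is returned only when the play is over: a strategy has to
    be total. *)
Definition cautious (n : nat) (m0 : move n) (h : history n) : move n :=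
  odflt m0 [pick m | safe_move h m].

Lemma cautious_safe (n : nat) (m0 : move n) (h : history n) (m : move n) :
  legal_move h m -> safe_move h (cautious m0 h).
Proof.
case/safe_move_exists=> m' safe_m'.
by rewrite /cautious; case: pickP => [// | /(_ m')]; rewrite safe_m'.
Qed.

Lemma legal_history_last (n : nat) (h : history n) (m : move n) :
  legal_history (rcons h m) -> legal_move h m.
Proof.
move E: (rcons h m) => h' legal_h'.
case: legal_h' E => [| h1 m1 _ legal_m1 /rcons_inj[-> ->] //].
by move/(congr1 size); rewrite size_rcons.
Qed.

Theorem theorem9 : forall n : nat, 3 <= n -> misere_SOS_draw n.
Proof.
move=> n n_ge3 p.
pose m0 : move n := (Ordinal (ltnW (ltnW n_ge3)), LetterS).
exists (cautious m0); split=> [h _ _ [m] /(cautious_safe m0)/andP[] // |].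
move=> h legal_h follows_h [h' [m [def_h turn_p]]]; apply/negP.
rewrite def_h in legal_h *.
have -> : m = cautious m0 h'.
  by apply: (follows_h h' [::]) => //; rewrite cats0.
by have /andP[] := cautious_safe m0 (legal_history_last legal_h).
Qed.
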